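(* Let $\Phi:\mathbb{M}_m\to\mathbb{M}_n$ be a Hermitian linear map with Choi matrix $\mathbf{C}_\Phi$. Let $k$ be the multiplicity of the smallest eigenvalue $\lambda_{\min}(\mathbf{C}_\Phi)=-d_{\mathrm{CP}}(\Phi)$ of $\mathbf{C}_\Phi$. Then, in any decomposition $\Phi=\Phi^{(1)}-\Phi^{(2)}$, where $\Phi^{(1)},\Phi^{(2)}:\mathbb{M}_m\to\mathbb{M}_n$ are completely positive maps, the following inequality holds: $$\|\Phi^{(2)}\|_{HS}\;\geq\;\sqrt{k}\,d_{\mathrm{CP}}(\Phi).$$ Moreover, this bound is sharp, meaning that there exists a decomposition $\Phi=\Phi^{(1)}-\Phi^{(2)}$ into completely positive maps for which equality $\|\Phi^{(2)}\|_{HS}=\sqrt{k}\,d_{\mathrm{CP}}(\Phi)$ is achieved.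
   Context: $\mathbb{M}_m$ is the algebra of $m\times m$ complex matrices. A linear map $\Phi:\mathbb{M}_m\to\mathbb{M}_n$ is Hermitian if $\Phi(A^* )=\Phi(A)^*$ for all $A\in\mathbb{M}_m$. It is completely positive (CP) if for every $k\ge 1$ the map $\mathrm{id}_{\mathbb{M}_k}\otimes\Phi:\mathbb{M}_k\otimes\mathbb{M}_m\to\mathbb{M}_k\otimes\mathbb{M}_n$ sends positive semi-definite matrices to positive semi-definite matrices. The Choi matrix of $\Phi$ is $\mathbf{C}_\Phi=\sum_{i,j=1}^m E_{ij}\otimes\Phi(E_{ij})\in\mathbb{M}_m\otimes\mathbb{M}_n$, where $E_{ij}$ are the standard matrix units of $\mathbb{M}_m$. The Hilbert-Schmidt norm of $\Phi$ is $\|\Phi\|_{HS}=\sqrt{\operatorname{tr}(\mathbf{C}_\Phi^*\mathbf{C}_\Phi)}$. The CP-distance of $\Phi$ is $d_{\mathrm{CP}}(\Phi)=\max\{0,-\lambda_{\min}(\mathbf{C}_\Phi)\}$, where $\lambda_{\min}$ denotes the smallest eigenvalue of a Hermitian matrix. The multiplicity of an eigenvalue $\lambda$ of a Hermitian matrix $A$ is $\dim\ker(A-\lambda I)$.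
   Formalization: Equality is false for some Φ (e.g. Choi matrix diag(-2,-1)); it is proved for each Φ whose Choi matrix has no negative eigenvalue other than the smallest, and, for all m, n, 1≤k≤mn and d≥0, for some Φ with multiplicity k and CP-distance d. *)

(* Defs.v *)
From HB Require Import structures.
From mathcomp Require Import all_boot all_order all_algebra.
From mathcomp Require Import spectral complex.
From mathcomp Require mxtens.
From mathcomp Require Import classical_sets reals.

Set Implicit Arguments.
Unset Strict Implicit.
Unset Printing Implicit Defensive.

Import Order.TTheory GRing.Theory Num.Theory.
Local Open Scope ring_scope.
Local Open Scope complex_scope.
Local Open Scope sesquilinear_scope.

Notation "A *t B" := (mxtens.tensmx A B)
  (at level 40, left associativity, format "A  *t  B") : ring_scope.

Section Matrices.
Variable R : realType.
Implicit Types N : nat.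

Definition psdmx N (A : 'M[R[i]]_N) : Prop :=
  A = A ^t* /\ forall u : 'cV[R[i]]_N, 0 <= (u ^t* *m A *m u) 0 0.

(* The eigenvalues of a Hermitian matrix are real, finitely many, and (in
   positive dimension) exist, so that the infimum is a minimum; see
   [lambda_minP]. *)
Definition lambda_min N (A : 'M[R[i]]_N) : R :=
  inf [set l : R | eigenvalue A l%:C]%classic.

(* [eigenspace A l] is the left kernel of A - l, which for a square matrix has
   the same dimension as the right kernel. *)
Definition multiplicity N (A : 'M[R[i]]_N) (l : R) : nat :=
  \rank (eigenspace A l%:C).

End Matrices.

Section Maps.
Variables (R : realType) (m n : nat).
Implicit Types Phi : {linear 'M[R[i]]_m -> 'M[R[i]]_n}.

Definition hermitian_map Phi : Prop :=
  forall A : 'M[R[i]]_m, Phi (A ^t*) = (Phi A) ^t*.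

(* M_k (x) M_m is identified with M_(k * m) by the Kronecker product [*t]. *)
Definition tens_block k (X : 'M[R[i]]_(k * m)) (a b : 'I_k) : 'M[R[i]]_m :=
  \matrix_(i, j) X (mxtens.mxtens_index (a, i)) (mxtens.mxtens_index (b, j)).

(* id (x) Phi, i.e. Phi applied to each block; characterized, together with
   linearity, by [id_tensE]. *)
Definition id_tens k Phi (X : 'M[R[i]]_(k * m)) : 'M[R[i]]_(k * n) :=
  \sum_(a < k) \sum_(b < k) (delta_mx a b : 'M_k) *t Phi (tens_block X a b).

Definition completely_positive Phi : Prop :=
  forall k : nat, (0 < k)%N ->
  forall X : 'M[R[i]]_(k * m), psdmx X -> psdmx (id_tens Phi X).

Definition choi Phi : 'M[R[i]]_(m * n) :=
  \sum_(i < m) \sum_(j < m) (delta_mx i j : 'M_m) *t Phi (delta_mx i j).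

(* The trace is a nonnegative real, so [complex.Re] only changes its type. *)
Definition HS_norm Phi : R :=
  Num.sqrt (complex.Re (\tr ((choi Phi) ^t* *m choi Phi))).

Definition d_CP Phi : R := Num.max 0 (- lambda_min (choi Phi)).

Lemma id_tensE k Phi (B : 'M[R[i]]_k) (A : 'M[R[i]]_m) :
  id_tens Phi (B *t A) = B *t Phi A.
Proof.
have blk a b : tens_block (B *t A) a b = B a b *: A.
  by apply/matrixP => i j; rewrite !mxE !mxtens.mxtens_indexK.
rewrite /id_tens; apply/matrixP => p q.
case: (mxtens.mxtens_indexP p) => a i; case: (mxtens.mxtens_indexP q) => b j.
rewrite mxtens.tensmxE summxE (bigD1 a) //= [X in _ + X]big1 ?addr0.
  rewrite summxE (bigD1 b) //= [X in _ + X]big1 ?addr0.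
    by rewrite mxtens.tensmxE blk linearZ !mxE !eqxx mul1r.
  by move=> c cb; rewrite mxtens.tensmxE mxE (eq_sym b) (negPf cb) andbF mul0r.
move=> c ca; rewrite summxE big1 // => d _.
by rewrite mxtens.tensmxE mxE (eq_sym a) (negPf ca) mul0r.
Qed.

Lemma id_tens_is_linear k Phi : linear (@id_tens k Phi).
Proof.
move=> c X Y; rewrite /id_tens scaler_sumr -big_split; apply: eq_bigr => a _ /=.
rewrite scaler_sumr -big_split; apply: eq_bigr => b _ /=.
have -> : tens_block (c *: X + Y) a b
          = c *: tens_block X a b + tens_block Y a b.
  by apply/matrixP => i j; rewrite !mxE.
by rewrite linearP; apply/matrixP => i j; rewrite !mxE mulrDr mulrCA.
Qed.

End Maps.

Lemma lambda_minP (R : realType) N (A : 'M[R[i]]_N) :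
  (0 < N)%N -> A = A ^t* ->
  eigenvalue A (lambda_min A)%:C /\
  (forall l : R[i], eigenvalue A l -> (lambda_min A)%:C <= l).
Proof.
move=> N_gt0 hA.
have real_ev l : eigenvalue A l -> l = (complex.Re l)%:C.
  move=> /eigenvalueP [v vA v0].
  have eq1 : v *m A *m v ^t* = l *: (v *m v ^t*) by rewrite vA -scalemxAl.
  have eq2 : v *m A *m v ^t* = l^* *: (v *m v ^t*).
    have vA' : A *m v ^t* = l^* *: v ^t*.
      rewrite {1}hA -map_mxM -trmx_mul vA.
      by apply/matrixP => i j; rewrite !mxE rmorphM.
    by rewrite -mulmxA vA' -scalemxAr.
  have nz : (v *m v ^t*) 0 0 != 0.
    rewrite mxE; apply: contra v0 => /eqP s0; apply/eqP/rowP => j.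
    have /psumr_eq0P := s0 => /(_ _ j isT) H; rewrite [RHS]mxE.
    have : v 0 j * (v ^t*) j 0 = 0.
      by apply: H => i _; rewrite !mxE; apply: mul_conjC_ge0.
    by rewrite !mxE => /eqP; rewrite mul_conjC_eq0 => /eqP.
  have : l = l^*.
    apply: (mulIf nz); have := congr1 (fun M : 'M_1 => M 0 0) eq1.
    by rewrite eq2 !mxE => ->.
  by case: (l) => x y [] /eqP; rewrite -addr_eq0 -mulr2n mulrn_eq0 /= => /eqP ->.
have cp0 : char_poly A != 0 by rewrite monic_neq0 ?char_poly_monic.
have [s sE] := closed_field_poly_normal (char_poly A).
have ev_s l : eigenvalue A l = (l \in s).
  by rewrite eigenvalue_root_char sE rootZ ?root_prod_XsubC // lead_coef_eq0.
have : size s = N.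
  apply: succn_inj; rewrite -(size_char_poly A) [in RHS]sE.
  by rewrite size_scale ?lead_coef_eq0 // size_prod_XsubC.
case: s => [|x0 s] in sE ev_s * => [N0|_]; first by rewrite -N0 in N_gt0.
have [m [mins le_m]] : exists m, m \in x0 :: s /\
    forall l, l \in x0 :: s -> complex.Re m <= complex.Re l.
  elim: (s) (x0) => [x|y t IH x].
    by exists x; split=> [|l]; rewrite inE // => /eqP->.
  have [m [mt le_m]] := IH y.
  have [le_xm|lt_mx] := leP (complex.Re x) (complex.Re m).
    exists x; split=> [|l]; first by rewrite inE eqxx.
    by rewrite inE => /orP[/eqP->//|/le_m]; apply: le_trans.
  exists m; split=> [|l]; first by rewrite inE mt orbT.
  by rewrite inE => /orP[/eqP->|/le_m//]; apply: ltW.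
have lminE : lambda_min A = complex.Re m.
  apply/eqP; rewrite eq_le; apply/andP; split.
    apply: ge_inf; last by rewrite /= -real_ev ?ev_s.
    by exists (complex.Re m) => l /=; rewrite ev_s => /le_m.
  apply: lb_le_inf; first by exists (complex.Re m); rewrite /= -real_ev ?ev_s.
  by move=> l /=; rewrite ev_s => /le_m.
rewrite lminE; split; first by rewrite -real_ev ?ev_s.
by move=> l ev_l; rewrite (real_ev _ ev_l) lecR le_m // -ev_s.
Qed.

(* Main.v *)
Require Import Defs.
From HB Require Import structures.
From mathcomp Require Import all_boot all_order all_algebra.
From mathcomp Require Import spectral complex.
From mathcomp Require mxtens.
From mathcomp Require Import reals.
Set Implicit Arguments.
Unset Strict Implicit.
Unset Printing Implicit Defensive.

Import Order.TTheory GRing.Theory Num.Theory.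
Local Open Scope ring_scope.
Local Open Scope complex_scope.
Local Open Scope sesquilinear_scope.

(** Write [C] for the Choi matrix of [Phi]. By Choi's theorem
    ([completely_positive_choi], [of_choi_completely_positive]) a map is
    completely positive iff its Choi matrix is positive semi-definite, and every
    matrix is the Choi matrix of exactly one map ([of_choiK], [choiK]). So the
    decompositions of [Phi] into completely positive maps are the ways of writing
    [C = C1 - C2] with [C1] and [C2] positive semi-definite, and the theorem
    concerns the least Frobenius norm of [C2].

    The Frobenius norm and positivity are invariant under unitary conjugation, so
    one may work in an orthonormal eigenbasis of the Hermitian matrix [C], with
    eigenvalues [l i]. There the diagonal entries satisfy [C2 i i >= 0] and
    [C2 i i = C1 i i - l i >= - l i], that is, [C2 i i] is at least the negative
    part of [l i]. Discarding the off-diagonal entries,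
    [||C2||^2 >= \sum_i (negative part of l i)^2] ([sqHS_negpart_le]). The [k]
    indices at which [l i] is the smallest eigenvalue contribute
    [k * d_CP Phi ^ 2] to this sum, which gives the bound ([HS_norm_ge_dCP]).

    The sum of squares is attained by the decomposition of [C] into its positive
    and negative parts ([posneg_decomposition]), and it equals
    [k * d_CP Phi ^ 2] as soon as the smallest eigenvalue is the only negative
    one ([dCP_decomposition]). A diagonal Choi matrix with [k] entries [-d] and
    the others equal to [1] then realizes every pair of values [k], [d]
    ([exists_choi_spectrum]). *)

(** * Positive semi-definite and Hermitian matrices *)

Section Psd.
Context {R : realType}.
Local Notation C := R[i].

Lemma adjmxM m n p (A : 'M[C]_(m, n)) (B : 'M[C]_(n, p)) :
  (A *m B) ^t* = B ^t* *m A ^t*.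
Proof. by rewrite trmx_mul map_mxM. Qed.

Lemma adjmx_sum (I : finType) m n (F : I -> 'M[C]_(m, n)) :
  (\sum_i F i) ^t* = \sum_i (F i) ^t*.
Proof.
apply/matrixP => p q; rewrite !mxE !summxE rmorph_sum.
by apply: eq_bigr => i _; rewrite !mxE.
Qed.

Lemma adjmx_tens m n p q (A : 'M[C]_(m, n)) (B : 'M[C]_(p, q)) :
  (A *t B) ^t* = A ^t* *t B ^t*.
Proof. by rewrite mxtens.trmx_tens mxtens.map_mxT. Qed.

Lemma adjmx_delta m n (i : 'I_m) (j : 'I_n) :
  (delta_mx i j : 'M[C]_(m, n)) ^t* = delta_mx j i.
Proof. by rewrite trmx_delta map_delta_mx. Qed.

Lemma psdmx_congr m n (V : 'M[C]_(m, n)) (A : 'M[C]_n) :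
  psdmx A -> psdmx (V *m A *m V ^t*).
Proof.
case=> hA posA; split; first by rewrite !adjmxM trmxCK -hA mulmxA.
move=> u; have := posA (V ^t* *m u).
by rewrite adjmxM trmxCK !mulmxA.
Qed.

Lemma psdmx_sum (I : finType) n (F : I -> 'M[C]_n) :
  (forall i, psdmx (F i)) -> psdmx (\sum_i F i).
Proof.
move=> psdF; split.
  by rewrite adjmx_sum; apply: eq_bigr => i _; case: (psdF i).
move=> u; rewrite mulmx_sumr mulmx_suml summxE sumr_ge0 // => i _.
by case: (psdF i).
Qed.

Lemma psdmx_diag n (l : 'I_n -> R) :
  (forall i, 0 <= l i) -> psdmx (diag_mx (\row_i (l i)%:C)).
Proof.
move=> l_ge0; split.
  apply/matrixP => i j; rewrite !mxE eq_sym; case: eqP => [->|_].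
    by rewrite !mulr1n; apply/esym/conjc_real.
  by rewrite !mulr0n rmorph0.
move=> u; rewrite mxE sumr_ge0 // => i _.
rewrite mul_mx_diag !mxE mulrAC mulr_ge0 ?ler0c // mulrC.
exact: mul_conjC_ge0.
Qed.

Lemma psdmx_outer n (v : 'cV[C]_n) : psdmx (v *m v ^t*).
Proof.
rewrite -{1}[v]mulmx1; apply: psdmx_congr.
have := @psdmx_diag 1 (fun=> 1) (fun=> ler01).
by congr psdmx; apply/matrixP => i j; rewrite !mxE rmorph1.
Qed.

(** The spectral normal form of a Hermitian matrix: for a unitary
    [U], the columns of [U ^t*] form an orthonormal eigenbasis, with real
    eigenvalues [l]. *)
Definition udiag {n} (U : 'M[C]_n) (l : 'I_n -> R) : 'M[C]_n :=
  U ^t* *m diag_mx (\row_i (l i)%:C) *m U.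

Lemma unitarymx_adjK n (U : 'M[C]_n) : U \is unitarymx -> U ^t* *m U = 1%:M.
Proof. by rewrite -trmxC_unitary => /unitarymxP; rewrite trmxCK. Qed.

Lemma udiag_conj n (U : 'M[C]_n) l :
  U \is unitarymx -> U *m udiag U l *m U ^t* = diag_mx (\row_i (l i)%:C).
Proof.
move=> /unitarymxP UU; rewrite /udiag !mulmxA UU mul1mx.
by rewrite -mulmxA UU mulmx1.
Qed.

Lemma psdmx_udiag n (U : 'M[C]_n) l :
  (forall i, 0 <= l i) -> psdmx (udiag U l).
Proof.
move=> l_ge0; rewrite /udiag -{2}[U]trmxCK; apply: psdmx_congr.
exact: psdmx_diag.
Qed.

Lemma udiagB n (U : 'M[C]_n) f g :
  udiag U f - udiag U g = udiag U (fun i => f i - g i).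
Proof.
rewrite /udiag -mulmxBl -mulmxBr -raddfB; congr (_ *m diag_mx _ *m _).
by apply/rowP => i; rewrite !mxE rmorphB.
Qed.

Lemma hermitian_udiag n (A : 'M[C]_n) :
  A = A ^t* -> exists U l, U \is unitarymx /\ A = udiag U l.
Proof.
move=> hA; have hermA : A \is hermsymmx.
  by apply/is_hermitianmxP; rewrite expr0 scale1r.
have /hermitian_normalmx/orthomx_spectralP := hermA.
rewrite invmx_unitary ?spectral_unitarymx // => {1}->.
exists (spectralmx A), (fun i => complex.Re (spectral_diag A 0 i)).
split; first exact: spectral_unitarymx.
congr (_ *m diag_mx _ *m _); apply/rowP => i; rewrite !mxE RRe_real //.
by have /mxOverP := hermitian_spectral_diag_real hermA.
Qed.

Lemma psdmx_diag_ge0 n (A : 'M[C]_n) i : psdmx A -> 0 <= A i i.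
Proof.
case=> _ /(_ (delta_mx i 0)).
by rewrite adjmx_delta -rowE -colE !mxE.
Qed.

(** The square root of the nonnegative spectrum. Such a factorization is what
    yields the Kraus operators of a map from its Choi matrix. *)
Lemma psdmx_gram n (A : 'M[C]_n) :
  psdmx A -> exists Z : 'M[C]_n, A = Z *m Z ^t*.
Proof.
move=> psdA; have [U [l [Uunit defA]]] := hermitian_udiag (proj1 psdA).
have l_ge0 i : 0 <= l i.
  have := psdmx_diag_ge0 i (psdmx_congr U psdA).
  by rewrite defA udiag_conj // !mxE eqxx ler0c.
exists (U ^t* *m diag_mx (\row_i (Num.sqrt (l i))%:C)).
rewrite adjmxM trmxCK mulmxA defA /udiag.
rewrite -(proj1 (psdmx_diag (fun i => sqrtr_ge0 (l i)))).
rewrite -[_ *m _ *m diag_mx _]mulmxA mulmx_diag.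
congr (_ *m diag_mx _ *m _); apply/rowP => i; rewrite !mxE.
by rewrite -rmorphM -expr2 sqr_sqrtr.
Qed.

End Psd.

(** * Eigenvalues and their multiplicities in spectral form *)

Section Eigen.
Context {R : realType}.
Local Notation C := R[i].

Lemma mxrank_diag_le n (d : 'rV[C]_n) :
  (\rank (diag_mx d) <= #|[pred i | (d 0 i != 0)%R]|)%N.
Proof.
rewrite -sum1_card diag_mx_sum_delta (bigID [pred i | d 0 i != 0]) /=.
rewrite [X in _ + X]big1 ?addr0; last first.
  by move=> i /negPn/eqP ->; rewrite scale0r.
elim/big_ind2: _ => [|A a B b leA leB|i _]; first by rewrite mxrank0.
  by rewrite (leq_trans (mxrank_add _ _)) // leq_add.
by rewrite (leq_trans (mxrankS (scalemx_sub _ (submx_refl _)))) ?mxrank_delta.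
Qed.

(** The upper bound [mxrank_diag_le] suffices: adding the diagonal matrix
    [d'] that fills the zeros of [d] with ones gives an invertible matrix, so
    the two ranks add up to at least [n], while the two upper bounds add up to
    exactly [n]. *)
Lemma mxrank_diag n (d : 'rV[C]_n) :
  \rank (diag_mx d) = #|[pred i | (d 0 i != 0)%R]|.
Proof.
apply/eqP; rewrite eqn_leq mxrank_diag_le /=.
pose d' : 'rV[C]_n := \row_i (d 0 i == 0)%:R.
have unit_dd' : diag_mx (d + d') \in unitmx.
  rewrite unitmxE det_diag unitfE prodf_seq_neq0; apply/allP => i _.
  rewrite !mxE; have [->|d_i] := eqVneq (d 0 i) 0.
    by rewrite add0r oner_eq0.
  by rewrite addr0.
have card_d' : (#|[pred i | (d 0 i != 0)%R]| + #|[pred i | (d' 0 i != 0)%R]|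
    = n)%N.
  rewrite -[RHS]card_ord -(cardC [pred i | (d 0 i != 0)%R]); congr (_ + _)%N.
  by apply: eq_card => i; rewrite !inE mxE pnatr_eq0 eqb0.
have := leq_add (leqnn (\rank (diag_mx d))) (mxrank_diag_le d').
move=> /(leq_trans (mxrank_add (diag_mx d) (diag_mx d'))).
by rewrite -raddfD /= mxrank_unit // -{1}card_d' leq_add2r.
Qed.

Lemma rank_eigenspace_udiag n (U : 'M[C]_n) l (c : C) : U \is unitarymx ->
  \rank (eigenspace (udiag U l) c) = #|[pred i | (l i)%:C == c]|.
Proof.
move=> Uunit; rewrite /eigenspace mxrank_ker.
have -> : udiag U l - c%:M
    = U ^t* *m diag_mx (\row_i ((l i)%:C - c)) *m U.
  have -> : c%:M = U ^t* *m c%:M *m U.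
    by rewrite scalar_mxC -mulmxA unitarymx_adjK // mulmx1.
  rewrite /udiag -mulmxBl -mulmxBr -diag_const_mx -raddfB.
  by congr (_ *m diag_mx _ *m _); apply/rowP => i; rewrite !mxE.
have Ufree : row_free U by rewrite row_free_unit unitarymx_unit.
have Ufull : row_full (U ^t*).
  by rewrite row_full_unit unitarymx_unit // trmxC_unitary.
rewrite mxrankMfree // (eqmxMfull _ Ufull) mxrank_diag.
set d := \row_i _.
have -> : #|[pred i | (d 0 i != 0)%R]| = #|[pred i | (l i)%:C != c]|.
  by apply: eq_card => i; rewrite !inE mxE subr_eq0.
apply/eqP; rewrite -(eqn_add2r #|[pred i | (l i)%:C != c]|) subnK.
  rewrite -[X in X == _]card_ord -(cardC [pred i | (l i)%:C == c]) eqn_add2l.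
  by apply/eqP/eq_card.
by rewrite -[X in (_ <= X)%N]card_ord max_card.
Qed.

Lemma multiplicity_udiag n (U : 'M[C]_n) l (x : R) : U \is unitarymx ->
  multiplicity (udiag U l) x = #|[pred i | l i == x]|.
Proof.
move=> Uunit; rewrite /multiplicity rank_eigenspace_udiag //.
by apply: eq_card => i; rewrite !inE (inj_eq (@complexI _)).
Qed.

Lemma eigenvalue_udiag n (U : 'M[C]_n) l (x : R) : U \is unitarymx ->
  eigenvalue (udiag U l) x%:C = [exists i, l i == x].
Proof.
move=> Uunit; rewrite /eigenvalue -mxrank_eq0 -lt0n.
rewrite -/(multiplicity _ _) multiplicity_udiag //.
by apply/card_gt0P/existsP => -[i hi]; exists i.
Qed.

Lemma udiag_adj n (U : 'M[C]_n) l : udiag U l = (udiag U l) ^t*.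
Proof.
rewrite /udiag !adjmxM trmxCK mulmxA; congr (_ *m _ *m _).
apply/matrixP => i j; rewrite !mxE eq_sym; case: eqP => [->|_].
  by rewrite !mulr1n; apply/esym/conjc_real.
by rewrite !mulr0n rmorph0.
Qed.

Lemma lambda_min_udiag n (U : 'M[C]_n) l : (0 < n)%N -> U \is unitarymx ->
  (exists i, l i = lambda_min (udiag U l)) /\
  (forall i, lambda_min (udiag U l) <= l i).
Proof.
move=> n_gt0 Uunit.
have [] := lambda_minP n_gt0 (udiag_adj U l).
rewrite eigenvalue_udiag // => /existsP[i /eqP li] lmin.
split=> [|j]; first by exists i.
by rewrite -lecR lmin // eigenvalue_udiag //; apply/existsP; exists j.
Qed.
End Eigen.

(** * Frobenius norm and negative part *)

Section HilbertSchmidt.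
Context {R : realType}.
Local Notation C := R[i].

(** The squared Frobenius norm, so that [HS_norm Phi] is by definition the
    square root of [sqHS (choi Phi)]. *)
Definition sqHS n (A : 'M[C]_n) : R := complex.Re (\tr (A ^t* *m A)).

Lemma sqHSE n (A : 'M[C]_n) :
  sqHS A = \sum_i \sum_j (complex.Re (A i j) ^+ 2 + complex.Im (A i j) ^+ 2).
Proof.
rewrite exchange_big /sqHS /mxtrace raddf_sum; apply: eq_bigr => j _ /=.
rewrite mxE raddf_sum; apply: eq_bigr => i _ /=; rewrite !mxE.
by case: (A i j) => x y /=; rewrite mulNr opprK.
Qed.

Lemma sqHS_conj n (U A : 'M[C]_n) :
  U \is unitarymx -> sqHS (U *m A *m U ^t*) = sqHS A.
Proof.
move=> Uunit; rewrite /sqHS !adjmxM trmxCK !mulmxA.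
rewrite -(mulmxA _ (U ^t*) U) unitarymx_adjK // mulmx1.
by rewrite mxtrace_mulC !mulmxA (unitarymx_adjK Uunit) mul1mx.
Qed.

Lemma sqHS_diag_le n (A : 'M[C]_n) :
  \sum_i complex.Re (A i i) ^+ 2 <= sqHS A.
Proof.
rewrite sqHSE; apply: ler_sum => i _; rewrite (bigD1 i) //= -addrA lerDl.
by rewrite addr_ge0 ?sqr_ge0 // sumr_ge0 // => j _; rewrite addr_ge0 ?sqr_ge0.
Qed.

Lemma sqHS_udiag n (U : 'M[C]_n) l :
  U \is unitarymx -> sqHS (udiag U l) = \sum_i l i ^+ 2.
Proof.
move=> Uunit; rewrite -(sqHS_conj _ Uunit) udiag_conj // sqHSE.
apply: eq_bigr => i _; rewrite (bigD1 i) //= big1 ?addr0.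
  by rewrite !mxE eqxx /= expr0n addr0.
by move=> j ji; rewrite !mxE eq_sym (negPf ji) /= expr0n addr0.
Qed.

(** With this choice [d_CP Phi] is by definition the negative part of the
    smallest eigenvalue of [choi Phi]. *)
Definition negpart (x : R) : R := Num.max 0 (- x).

Lemma negpart_ge0 x : 0 <= negpart x.
Proof. by rewrite /negpart le_max lexx. Qed.

(** Among all ways of subtracting a positive semi-definite matrix from another
    to get a given Hermitian matrix, the subtrahend of least norm is the
    negative part: in an eigenbasis it is already dominated by the diagonal of [A2]. *)
Lemma sqHS_negpart_le n (U A1 A2 : 'M[C]_n) l : U \is unitarymx ->
  psdmx A1 -> psdmx A2 -> udiag U l = A1 - A2 ->
  \sum_i negpart (l i) ^+ 2 <= sqHS A2.
Proof.
move=> Uunit psd1 psd2 /(congr1 (fun A => U *m A *m U ^t*)).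
rewrite udiag_conj // mulmxBr mulmxBl => defD.
rewrite -(sqHS_conj _ Uunit); apply: le_trans (sqHS_diag_le _).
apply: ler_sum => i _.
have := psdmx_diag_ge0 i (psdmx_congr U psd1).
have := psdmx_diag_ge0 i (psdmx_congr U psd2).
have := congr1 (fun D : 'M_n => complex.Re (D i i)) defD.
rewrite !mxE eqxx /= raddfD raddfN /= !lecE /= => li /andP[_ a2] /andP[_ a1].
rewrite lerXn2r ?nnegrE ?negpart_ge0 // /negpart ge_max a2 li /=.
by rewrite opprB lerBlDr lerDl.
Qed.

Lemma sum_negpart_ge n (l : 'I_n -> R) x :
  #|[pred i | l i == x]|%:R * negpart x ^+ 2 <= \sum_i negpart (l i) ^+ 2.
Proof.
rewrite mulr_natl -sumr_const [leRHS](bigID [pred i | l i == x]) /=.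
rewrite [X in _ <= X + _](eq_bigr (fun=> negpart x ^+ 2)).
  by rewrite lerDl sumr_ge0 // => i _; rewrite sqr_ge0.
by move=> i /eqP ->.
Qed.

Lemma sum_negpart n (l : 'I_n -> R) x : (forall i, l i < 0 -> l i = x) ->
  \sum_i negpart (l i) ^+ 2 = #|[pred i | l i == x]|%:R * negpart x ^+ 2.
Proof.
move=> lx; rewrite mulr_natl -sumr_const [LHS](bigID [pred i | l i == x]) /=.
rewrite [X in X + _](eq_bigr (fun=> negpart x ^+ 2)); last by move=> i /eqP ->.
rewrite [X in _ + X]big1 ?addr0 // => i lix.
have l_ge0 : 0 <= l i by rewrite leNgt; apply: contra lix => /lx ->.
by rewrite /negpart max_l ?expr0n // oppr_le0.
Qed.

End HilbertSchmidt.

(** * Choi matrices and complete positivity *)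

Section Choi.
Context {R : realType}.
Local Notation C := R[i].
Local Notation idx i p := (mxtens.mxtens_index (i, p)).

Lemma sum_delta_tensE k n (F : 'I_k -> 'I_k -> 'M[C]_n) a b p q :
  (\sum_(i < k) \sum_(j < k) (delta_mx i j : 'M_k) *t F i j) (idx a p) (idx b q)
  = F a b p q.
Proof.
rewrite summxE (bigD1 a) //= [X in _ + X]big1 ?addr0.
  rewrite summxE (bigD1 b) //= [X in _ + X]big1 ?addr0.
    by rewrite mxtens.tensmxE !mxE !eqxx mul1r.
  by move=> c cb; rewrite mxtens.tensmxE mxE (eq_sym b) (negPf cb) andbF mul0r.
move=> c ca; rewrite summxE big1 // => d _.
by rewrite mxtens.tensmxE mxE (eq_sym a) (negPf ca) mul0r.
Qed.

Lemma eq_tensmx k n (A B : 'M[C]_(k * n)) :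
  (forall a b p q, A (idx a p) (idx b q) = B (idx a p) (idx b q)) -> A = B.
Proof.
move=> AB; apply/matrixP => x y.
by case: (mxtens.mxtens_indexP x) => a p; case: (mxtens.mxtens_indexP y).
Qed.

Lemma tensmx_sumr (I : finType) k n (A : 'M[C]_k) (F : I -> 'M[C]_n) :
  A *t (\sum_t F t) = \sum_t A *t F t.
Proof.
apply: eq_tensmx => a b p q; rewrite summxE mxtens.tensmxE summxE mulr_sumr.
by apply: eq_bigr => t _; rewrite mxtens.tensmxE.
Qed.

Lemma sum_tens_block k n (X : 'M[C]_(k * n)) :
  X = \sum_(a < k) \sum_(b < k) (delta_mx a b : 'M_k) *t tens_block X a b.
Proof. by apply: eq_tensmx => a b p q; rewrite sum_delta_tensE mxE. Qed.

Section Maps.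
Variables m n : nat.
Implicit Types Phi : {linear 'M[C]_m -> 'M[C]_n}.

Lemma choiE Phi i j p q :
  choi Phi (idx i p) (idx j q) = Phi (delta_mx i j) p q.
Proof. exact: sum_delta_tensE. Qed.

Lemma choi_adj Phi : hermitian_map Phi -> choi Phi = (choi Phi) ^t*.
Proof.
move=> hPhi; apply: eq_tensmx => i j p q; rewrite [RHS]mxE [in RHS]mxE !choiE.
have := congr1 (fun M : 'M_n => M p q) (hPhi (delta_mx j i)).
by rewrite adjmx_delta !mxE.
Qed.

(** The Choi matrix is the image under [id (x) Phi] of the unnormalized
    maximally entangled state [v v^*], where [v] is the sum of the
    [e_i (x) e_i]. *)
Lemma completely_positive_choi Phi :
  (0 < m)%N -> completely_positive Phi -> psdmx (choi Phi).
Proof.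
move=> m_gt0 cpPhi.
pose v : 'cV[C]_(m * m) := \col_x
  ((mxtens.mxtens_unindex x).1 == (mxtens.mxtens_unindex x).2)%:R.
suff -> : choi Phi = id_tens Phi (v *m v ^t*) by apply/cpPhi/psdmx_outer.
apply: eq_bigr => i _; apply: eq_bigr => j _; congr (_ *t Phi _).
apply/matrixP => a b; rewrite !mxE big_ord1 !mxE !mxtens.mxtens_indexK /=.
by rewrite rmorph_nat -natrM mulnb (eq_sym a) (eq_sym b).
Qed.

(** In Kraus form [id (x) Phi] is a sum of the congruences
    [X |-> (1 (x) K t) X (1 (x) K t)^*], each of which preserves positivity. *)
Lemma kraus_completely_positive Phi (I : finType) (K : I -> 'M[C]_(n, m)) :
  (forall A, Phi A = \sum_t K t *m A *m (K t) ^t*) -> completely_positive Phi.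
Proof.
move=> PhiE k _ X psdX.
suff -> : id_tens Phi X
    = \sum_t ((1%:M : 'M_k) *t K t) *m X *m ((1%:M : 'M_k) *t K t) ^t*.
  by apply: psdmx_sum => t; apply: psdmx_congr.
under [RHS]eq_bigr => t _.
  rewrite {1}[X]sum_tens_block mulmx_sumr mulmx_suml.
  under eq_bigr => a _.
    rewrite mulmx_sumr mulmx_suml.
    under eq_bigr => b _.
      rewrite adjmx_tens trmx1 map_mx1 !mxtens.tensmx_mul mul1mx mulmx1.
      over.
    over.
  over.
rewrite exchange_big; apply: eq_bigr => a _ /=.
rewrite exchange_big; apply: eq_bigr => b _ /=.
by rewrite PhiE tensmx_sumr.
Qed.

(** The inverse of the Choi isomorphism [Phi |-> choi Phi]. *)
Definition of_choi (D : 'M[C]_(m * n)) (A : 'M[C]_m) : 'M[C]_n :=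
  \matrix_(p, q) \sum_i \sum_j A i j * D (idx i p) (idx j q).

Lemma of_choi_is_linear D : linear (of_choi D).
Proof.
move=> c A B; apply/matrixP => p q; rewrite !mxE mulr_sumr -big_split /=.
apply: eq_bigr => i _; rewrite mulr_sumr -big_split; apply: eq_bigr => j _ /=.
by rewrite !mxE mulrDl mulrA.
Qed.

HB.instance Definition _ D :=
  GRing.isLinear.Build C 'M[C]_m 'M[C]_n _ (of_choi D) (of_choi_is_linear D).

Lemma of_choiK D : choi (of_choi D) = D.
Proof.
apply: eq_tensmx => i j p q; rewrite choiE mxE (bigD1 i) //= (bigD1 j) //=.
rewrite mxE !eqxx mul1r !big1 ?addr0 // => [a ai|b bj].
  by rewrite big1 // => b _; rewrite mxE (negPf ai) mul0r.
by rewrite mxE (negPf bj) andbF mul0r.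
Qed.

Lemma choiK Phi A : of_choi (choi Phi) A = Phi A.
Proof.
rewrite {2}[A]matrix_sum_delta raddf_sum.
apply/matrixP => p q; rewrite mxE summxE; apply: eq_bigr => i _.
rewrite raddf_sum summxE; apply: eq_bigr => j _.
by rewrite choiE /= linearZ mxE.
Qed.

Lemma of_choiB D1 D2 A : of_choi (D1 - D2) A = of_choi D1 A - of_choi D2 A.
Proof.
apply/matrixP => p q; rewrite !mxE -sumrB; apply: eq_bigr => i _.
by rewrite -sumrB; apply: eq_bigr => j _; rewrite !mxE mulrBr.
Qed.

Lemma choiB Phi Phi1 Phi2 :
  (forall A, Phi A = Phi1 A - Phi2 A) -> choi Phi = choi Phi1 - choi Phi2.
Proof.
by move=> PhiE; apply: eq_tensmx => i j p q; rewrite !mxE !choiE PhiE !mxE.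
Qed.

Lemma hermitian_of_choi D : D = D ^t* -> hermitian_map (of_choi D).
Proof.
move=> hD A; apply/matrixP => p q; rewrite !mxE exchange_big rmorph_sum.
apply: eq_bigr => i _ /=; rewrite rmorph_sum; apply: eq_bigr => j _ /=.
by rewrite {1}hD !mxE rmorphM.
Qed.

(** Reshaping the columns of [Z] in [D = Z Z^*] into matrices gives Kraus
    operators for the map. *)
Lemma of_choi_completely_positive D :
  psdmx D -> completely_positive (of_choi D).
Proof.
case/psdmx_gram => Z ->.
pose K t : 'M[C]_(n, m) := \matrix_(p, i) Z (idx i p) t.
apply: (@kraus_completely_positive _ _ K) => A.
apply/matrixP => p q; rewrite mxE summxE.
under [RHS]eq_bigr => t _.
  rewrite mxE.
  under eq_bigr => j _ do rewrite !mxE mulr_suml.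
  rewrite exchange_big.
  over.
rewrite [RHS]exchange_big; apply: eq_bigr => i _ /=.
rewrite [RHS]exchange_big; apply: eq_bigr => j _ /=.
rewrite mxE mulr_sumr; apply: eq_bigr => t _.
by rewrite !mxE mulrCA mulrA.
Qed.

End Maps.
End Choi.

(** * Decompositions into completely positive maps *)

Section Decomposition.
Context {R : realType}.
Variables m n : nat.
Local Notation C := R[i].
Implicit Types Phi : {linear 'M[C]_m -> 'M[C]_n}.

(** The positive and negative parts of the Choi matrix are the optimal choice in
    [sqHS_negpart_le]. *)
Lemma posneg_decomposition Phi (U : 'M[C]_(m * n)) l :
  U \is unitarymx -> choi Phi = udiag U l ->
  exists Phi1 Phi2 : {linear 'M[C]_m -> 'M[C]_n},
    [/\ completely_positive Phi1, completely_positive Phi2,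
        forall A, Phi A = Phi1 A - Phi2 A &
        HS_norm Phi2 = Num.sqrt (\sum_i negpart (l i) ^+ 2)].
Proof.
move=> Uunit choiPhi.
exists (of_choi (udiag U (fun i => Num.max 0 (l i)))).
exists (of_choi (udiag U (fun i => negpart (l i)))); split.
- apply/of_choi_completely_positive/psdmx_udiag => i.
  by rewrite le_max lexx.
- by apply/of_choi_completely_positive/psdmx_udiag => i; apply: negpart_ge0.
- move=> A; rewrite -choiK choiPhi -of_choiB udiagB; congr (of_choi _ A).
  congr (_ *m diag_mx _ *m _); apply/rowP => i; rewrite !mxE /negpart.
  congr (_%:C); have [l_ge0|/ltW l_le0] := leP 0 (l i).
    by rewrite max_l ?oppr_le0 // subr0.
  by rewrite max_r ?oppr_ge0 // sub0r opprK.
- by rewrite /HS_norm -/(sqHS _) of_choiK sqHS_udiag.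
Qed.

Lemma sqrt_mult_dCP (k : nat) Phi :
  Num.sqrt k%:R * d_CP Phi = Num.sqrt (k%:R * d_CP Phi ^+ 2).
Proof.
by rewrite sqrtrM ?ler0n // sqrtr_sqr ger0_norm // negpart_ge0.
Qed.

Lemma HS_norm_ge_dCP Phi Phi1 Phi2 : (0 < m)%N ->
  hermitian_map Phi -> completely_positive Phi1 -> completely_positive Phi2 ->
  (forall A, Phi A = Phi1 A - Phi2 A) ->
  Num.sqrt (multiplicity (choi Phi) (lambda_min (choi Phi)))%:R * d_CP Phi
    <= HS_norm Phi2.
Proof.
move=> m_gt0 /choi_adj/hermitian_udiag[U [l [Uunit choiPhi]]] cp1 cp2 PhiE.
rewrite sqrt_mult_dCP /HS_norm -/(sqHS _) ler_wsqrtr //.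
rewrite {1}choiPhi multiplicity_udiag //.
apply: le_trans (sum_negpart_ge _ _) _.
apply: sqHS_negpart_le Uunit (completely_positive_choi m_gt0 cp1)
  (completely_positive_choi m_gt0 cp2) _.
by rewrite -choiPhi (choiB PhiE).
Qed.

(** When no eigenvalue other than the smallest one is negative, the negative part
    of the Choi matrix is [d_CP Phi] times the projection onto the eigenspace
    of the smallest eigenvalue. *)
Lemma dCP_decomposition Phi : hermitian_map Phi ->
  (forall x : R, eigenvalue (choi Phi) x%:C -> x < 0 ->
     x = lambda_min (choi Phi)) ->
  exists Phi1 Phi2 : {linear 'M[C]_m -> 'M[C]_n},
    [/\ completely_positive Phi1, completely_positive Phi2,
        forall A, Phi A = Phi1 A - Phi2 A &
        HS_norm Phi2 = Num.sqrt
          (multiplicity (choi Phi) (lambda_min (choi Phi)))%:R * d_CP Phi].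
Proof.
move=> /choi_adj/hermitian_udiag[U [l [Uunit choiPhi]]] neg_min.
have [Phi1 [Phi2 [cp1 cp2 PhiE normE]]] := posneg_decomposition Uunit choiPhi.
exists Phi1, Phi2; split=> //; rewrite normE sqrt_mult_dCP.
rewrite {1}choiPhi multiplicity_udiag //.
rewrite (sum_negpart (x := lambda_min (choi Phi))) //.
move=> i /neg_min; apply; rewrite choiPhi eigenvalue_udiag //.
by apply/existsP; exists i.
Qed.

(** The remaining eigenvalues are set to [1] rather than [0], so that [- d] keeps
    multiplicity exactly [k] even for [d = 0]. *)
Lemma exists_choi_spectrum (k : nat) (d : R) :
  (0 < k <= m * n)%N -> 0 <= d ->
  exists Phi : {linear 'M[C]_m -> 'M[C]_n},
    [/\ hermitian_map Phi, lambda_min (choi Phi) = - d,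
        multiplicity (choi Phi) (- d) = k &
        forall x : R, eigenvalue (choi Phi) x%:C -> x < 0 -> x = - d].
Proof.
move=> /andP[k_gt0 k_le] d_ge0.
have mn_gt0 : (0 < m * n)%N := leq_trans k_gt0 k_le.
pose l (i : 'I_(m * n)) : R := if (i < k)%N then - d else 1.
have U1 : (1%:M : 'M[C]_(m * n)) \is unitarymx.
  by apply/unitarymxP; rewrite trmx1 map_mx1 mul1mx.
have ltd1 : - d < 1 by rewrite (le_lt_trans _ ltr01) ?oppr_le0.
exists (of_choi (udiag 1%:M l)); rewrite of_choiK.
have [[i0 li0] lmin] := lambda_min_udiag l mn_gt0 U1.
split.
- by apply: hermitian_of_choi; apply: udiag_adj.
- apply/eqP; rewrite eq_le -{2}li0; apply/andP; split.
    by have := lmin (Ordinal mn_gt0); rewrite {2}/l /= k_gt0.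
  by rewrite /l; case: ifP => _ //; rewrite ltW.
- rewrite multiplicity_udiag //.
  rewrite -[RHS]subn0 -sum1_card -[RHS]muln1 -sum_nat_const_nat big_mkord.
  rewrite (big_ord_widen _ (fun=> 1%N) k_le); apply: eq_bigl => i.
  by rewrite !inE /l; case: ifP; rewrite ?eqxx // gt_eqF.
- move=> x; rewrite eigenvalue_udiag // => /existsP[i /eqP <-].
  by rewrite /l; case: ifP => // _; rewrite ltr10.
Qed.
End Decomposition.
Unset Implicit Arguments.

Theorem theorem2p2 (R : realType) (m n : nat) (m_gt0 : (0 < m)%N)
    (n_gt0 : (0 < n)%N) :
  (* the bound, and its attainment for every Phi for which it is attainable *)
  (forall (Phi : {linear 'M[R[i]]_m -> 'M[R[i]]_n}) (k : nat),
     hermitian_map Phi ->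
     k = multiplicity (choi Phi) (lambda_min (choi Phi)) ->
     (forall Phi1 Phi2 : {linear 'M[R[i]]_m -> 'M[R[i]]_n},
        completely_positive Phi1 -> completely_positive Phi2 ->
        (forall A, Phi A = Phi1 A - Phi2 A) ->
        HS_norm Phi2 >= Num.sqrt k%:R * d_CP Phi) /\
     ((forall l : R, eigenvalue (choi Phi) l%:C -> l < 0 ->
         l = lambda_min (choi Phi)) ->
      exists Phi1 Phi2 : {linear 'M[R[i]]_m -> 'M[R[i]]_n},
        [/\ completely_positive Phi1, completely_positive Phi2,
            forall A, Phi A = Phi1 A - Phi2 A &
            HS_norm Phi2 = Num.sqrt k%:R * d_CP Phi])) /\
  (* the bound cannot be improved, for any value of its parameters *)
  (forall (k : nat) (d : R), (0 < k <= m * n)%N -> 0 <= d ->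
     exists Phi : {linear 'M[R[i]]_m -> 'M[R[i]]_n},
       [/\ hermitian_map Phi,
           k = multiplicity (choi Phi) (lambda_min (choi Phi)),
           lambda_min (choi Phi) = - d_CP Phi,
           d_CP Phi = d &
           exists Phi1 Phi2 : {linear 'M[R[i]]_m -> 'M[R[i]]_n},
             [/\ completely_positive Phi1, completely_positive Phi2,
                 forall A, Phi A = Phi1 A - Phi2 A &
                 HS_norm Phi2 = Num.sqrt k%:R * d_CP Phi]]).
Proof.
split=> [Phi _ hPhi ->|k d k_bound d_ge0].
  split=> [Phi1 Phi2|]; first exact: HS_norm_ge_dCP.
  exact: dCP_decomposition.
have [Phi [hPhi lminE multE neg_min]] :=
  exists_choi_spectrum k_bound d_ge0.
have dE : d_CP Phi = d by rewrite /d_CP lminE opprK max_r.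
exists Phi; split; rewrite ?lminE ?dE //.
rewrite -lminE in neg_min multE.
have := dCP_decomposition hPhi neg_min.
by rewrite multE dE.
Qed.
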